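(* Let $r,s$ be integers with $1\le r\le s$ and let $p$ be a prime. Let $\lambda=\lambda(r,s,p)=(\lambda_1,\dots,\lambda_r)$, $\varepsilon=(\lambda_1-s,\dots,\lambda_r-s)$, and $T=\{i\in[r-1]\mid\delta_i=1\}$. Then (a) $\varepsilon=T^{\Phi_{\mathcal{T}\mathcal{E}}}\in\mathcal{E}$; (b) if $T=\{t_1,\dots,t_{|T|}\}$ and $0=t_0<t_1<\cdots<t_{|T|}<t_{|T|+1}=r$, then $$\pi(r,s,p)=T^{\Phi_{\mathcal{T}\Pi}}=\prod_{i=0}^{|T|}\mathrm{Rev}(t_i+1,t_{i+1});$$ (c) $n^{\pi(r,s,p)}=n+1-L(n)+R(n)$ for each $n\in[r]$; (d) $\lambda_n=r+s-2n+L(n)-R(n)$ for each $n\in[r]$.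
   Context: Write $[r]=\{1,\dots,r\}$. Let $N_\ell$ be the $\ell\times\ell$ matrix with $1$ in entries $(i,i+1)$, $1\le i<\ell$, and zeros elsewhere, and $J_\ell=I_\ell+N_\ell$ (unipotent Jordan block). For $1\le r\le s$ and a prime $p$, over any field of characteristic $p$ the Jordan canonical form of $J_r\otimes J_s$ is $\bigoplus_{i=1}^r J_{\lambda_i}$ with $\lambda_1\ge\cdots\ge\lambda_r>0$ and $\sum_i\lambda_i=rs$; the partition $\lambda(r,s,p):=(\lambda_1,\dots,\lambda_r)$ has exactly $r$ nonzero parts and depends only on $r,s,p$. The map $\pi(r,s,p):[r]\to[r]$ is the permutation $n\mapsto n^{\pi(r,s,p)}=(r+1-n)+s-\lambda_n$. For $n\in[r]$, $D_n(r,s)$ is the determinant of the $n\times n$ matrix with $(i,j)$-entry $\binom{s+r-2n}{s-n+i-j}$, $0\le i,j\le n-1$; equivalently $D_n(r,s)=\prod_{i=0}^{n-1}\binom{s+r-2n+i}{s-n}\big/\binom{s-n+i}{s-n}$. Set $D_0(r,s)=1$; also $D_r(r,s)=1$. For $0\le n\le r$ let $\delta_n=0$ if $p\mid D_n(r,s)$ and $\delta_n=1$ otherwise. For $n\in[r]$, $L(n)$ is the smallest positive integer with $\delta_{n-L(n)}=1$, and $R(n)$ is the least nonnegative integer with $\delta_{n+R(n)}=1$ (these exist since $\delta_0=\delta_r=1$). For $1\le i\le j\le r$, $\mathrm{Rev}(i,j)$ is the permutation of $[r]$ sending $n$ to $i+j-n$ for $i\le n\le j$ and fixing all other points. $\mathcal{T}$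 is the set of all subsets of $[r-1]$. For $T=\{t_1<\cdots<t_{|T|}\}\in\mathcal{T}$, with $t_0:=0$ and $t_{|T|+1}:=r$, $T^{\Phi_{\mathcal{T}\Pi}}:=\pi_T:=\prod_{i=0}^{|T|}\mathrm{Rev}(t_i+1,t_{i+1})$. $\mathcal{E}$ is the set of all $\varepsilon=(\varepsilon_1,\dots,\varepsilon_r)\in\mathbb{Z}^r$ with $\varepsilon_1\ge\cdots\ge\varepsilon_r$, $\varepsilon_i-\varepsilon_j\ne j-i$ for $1\le i<j\le r$, and $1-n\le\varepsilon_n\le r-n$ for $1\le n\le r$. The map $\Phi_{\mathcal{E}\mathcal{T}}:\mathcal{E}\to\mathcal{T}$, $\varepsilon\mapsto\{t\in[r-1]\mid\varepsilon_t>\varepsilon_{t+1}\}$, is a bijection, and $\Phi_{\mathcal{T}\mathcal{E}}:=\Phi_{\mathcal{E}\mathcal{T}}^{-1}$. *)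

(* Defs.v *)
From HB Require Import structures.
From mathcomp Require Import all_boot all_order all_fingroup all_algebra.
From mathcomp Require Import zify mxtens.

Set Implicit Arguments.
Unset Strict Implicit.
Unset Printing Implicit Defensive.

Import Order.TTheory GRing.Theory Num.Theory.
Local Open Scope ring_scope.

(* Indexing convention: the set [m] = {1, ..., m} is represented by 'I_m, the
   ordinal i standing for the integer i + 1.  In particular the subsets of
   [r - 1] are the elements of {set 'I_r.-1}, and the n-th entry of an r-tuple
   v is v`_n.-1. *)

Section JordanPartition.
Variable F : fieldType.

Definition nil_block (l : nat) : 'M[F]_l := \matrix_(i, j) (j == i.+1 :> nat)%:R.

Definition jordan_block (l : nat) : 'M[F]_l := 1%:M + nil_block l.

(* Similarity of square matrices whose sizes need not be syntactically equal;
   the two equations force m = n. *)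
Definition similar_mx (m n : nat) (A : 'M[F]_m) (B : 'M[F]_n) : Prop :=
  exists P : 'M[F]_(m, n), exists Q : 'M[F]_(n, m),
    [/\ P *m Q = 1%:M, Q *m P = 1%:M & Q *m A *m P = B].

(* lam is the partition lambda(r, s, p), computed over the field F of
   characteristic p.  Comparing dimensions, the similarity forces the parts to
   add up to r * s. *)
Definition is_jordan_partition (r s : nat) (lam : r.-tuple nat) : Prop :=
  [/\ sorted geq lam,
      all (leq 1) lam &
      similar_mx (jordan_block r *t jordan_block s)
                 (\mxdiag_(i < r) jordan_block (tnth lam i))].

End JordanPartition.

(* n |-> (r + 1 - n) + s - lambda_n, as an integer-valued map on [r]. *)
Definition jordan_pi (r s : nat) (lam : r.-tuple nat) (i : 'I_r) : int :=
  let n := i.+1%:Z in (r%:Z + 1 - n) + s%:Z - (tnth lam i)%:Z.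

Definition jordan_eps (r s : nat) (lam : r.-tuple nat) : r.-tuple int :=
  [tuple (tnth lam i)%:Z - s%:Z | i < r].

(* Binomial coefficient with an integer lower index; it vanishes when the
   lower index is negative. *)
Definition binz (m : nat) (k : int) : int :=
  if k is Posz k' then 'C(m, k')%:Z else 0.

(* Only used for n <= r <= s, where s + r - 2 * n is not truncated. *)
Definition Ddet (r s n : nat) : int :=
  \det (\matrix_(i < n, j < n)
          binz (s + r - 2 * n) (s%:Z - n%:Z + i%:Z - j%:Z)).

Definition delta (r s p n : nat) : bool := ~~ (p %| Ddet r s n)%Z.

(* The default witnesses ord_max correspond to n - L = 0 and n + R = r, where
   delta holds because D_0 = D_r = 1. *)
Definition Lfun (r s p n : nat) : nat :=
  [arg min_(l < (ord_max : 'I_n.+1) | (0 < l)%N && delta r s p (n - l)) l].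

Definition Rfun (r s p n : nat) : nat :=
  [arg min_(k < (ord_max : 'I_(r - n).+1) | delta r s p (n + k)) k].

Definition Tset (r s p : nat) : {set 'I_r.-1} :=
  [set t : 'I_r.-1 | delta r s p t.+1].

Section Reversals.
Variable r : nat.

(* Outside of 1 <= i <= j <= r this is the identity. *)
Definition rev_fun (i j : nat) (x : 'I_r) : 'I_r :=
  let n := x.+1 in
  if [&& 0 < i, i <= n <= j & j <= r]%N then insubd x (i + j - n).-1 else x.

Lemma rev_funE i j (x : 'I_r) : (0 < i)%N -> (j <= r)%N ->
  (rev_fun i j x).+1 = (if i <= x.+1 <= j then i + j - x.+1 else x.+1)%N.
Proof.
move=> i_gt0 jr; rewrite /rev_fun i_gt0 jr andbT /=.
case: ifP => // /andP[ix xj]; rewrite val_insubd.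
have -> : ((i + j - x.+1).-1 < r)%N by lia.
by lia.
Qed.

Lemma rev_fun_inj i j : injective (rev_fun i j).
Proof.
case: (boolP ((0 < i) && (j <= r))%N) => [/andP[i0 jr] x y exy|ij x y].
  have := rev_funE x i0 jr; rewrite exy (rev_funE y i0 jr) => exy'.
  by apply: val_inj => /=; move: exy'; do 2 case: ifP => ?; lia.
rewrite /rev_fun; case: ifP => [/and3P[-> _ ->]|_] in ij *; first by lia.
by case: ifP => [/and3P[i0 _ jr]|//]; move: ij; rewrite i0 jr.
Qed.

Definition Rev (i j : nat) : 'S_r := perm (@rev_fun_inj i j).

(* cutpoint T i is t_i: t_0 = 0, then the elements of T in increasing order,
   then t_(#|T| + 1) = r. *)
Definition cutpoint (T : {set 'I_r.-1}) (i : nat) : nat :=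
  nth r (0%N :: [seq (val t).+1 | t <- enum T]) i.

Definition Phi_TPi (T : {set 'I_r.-1}) : 'S_r :=
  (\prod_(i < #|T|.+1) Rev (cutpoint T i).+1 (cutpoint T i.+1))%g.

End Reversals.

Section EpsilonSequences.
Variable r : nat.

(* The second condition only involves the difference of the two indices, so it
   is insensitive to the indexing convention. *)
Definition in_E (e : r.-tuple int) : bool :=
  [&& [forall i : 'I_r, forall j : 'I_r,
         (i <= j)%N ==> (tnth e j <= tnth e i)],
      [forall i : 'I_r, forall j : 'I_r,
         (i < j)%N ==> (tnth e i - tnth e j != j%:Z - i%:Z)] &
      [forall i : 'I_r,
         let n := i.+1%:Z in (1 - n <= tnth e i) && (tnth e i <= r%:Z - n)]].

(* The entry of e of index k + 1. *)
Definition entry (e : r.-tuple int) (k : nat) : int := nth 0 e k.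

Definition Eset : Type := {e : r.-tuple int | in_E e}.

Definition Phi_ET (e : Eset) : {set 'I_r.-1} :=
  [set t : 'I_r.-1 | entry (val e) (t.+1) < entry (val e) t].

Lemma in_EP (e : r.-tuple int) :
  reflect
    [/\ forall i j, (i <= j)%N -> (j < r)%N -> entry e j <= entry e i,
        forall i j, (i < j)%N -> (j < r)%N -> entry e i - entry e j <> j%:Z - i%:Z &
        forall i, (i < r)%N -> - i%:Z <= entry e i <= r%:Z - i.+1%:Z]
    (in_E e).
Proof.
apply: (iffP and3P) => [[/forallP h1 /forallP h2 /forallP h3]|[h1 h2 h3]].
  split=> [i j ij jr|i j ij jr|i ir].
  - have ir := leq_ltn_trans ij jr.
    have /forallP/(_ (Ordinal jr))/implyP/(_ ij) := h1 (Ordinal ir).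
    by rewrite !(tnth_nth 0).
  - have ir := ltn_trans ij jr.
    have /forallP/(_ (Ordinal jr))/implyP/(_ ij) := h2 (Ordinal ir).
    by rewrite !(tnth_nth 0) /= => /eqP.
  - by have := h3 (Ordinal ir); rewrite !(tnth_nth 0) -/(entry e i) /=; lia.
split; apply/forallP=> i.
- by apply/forallP=> j; apply/implyP=> ij; rewrite !(tnth_nth 0); apply: h1.
- apply/forallP=> j; apply/implyP=> ij; rewrite !(tnth_nth 0).
  by apply/eqP; apply: h2.
- by have := h3 i (ltn_ord i); rewrite (tnth_nth 0) -/(entry e i) /=; lia.
Qed.

Lemma Phi_ET_surj (T : {set 'I_r.-1}) : exists e : Eset, Phi_ET e == T.
Proof.
pose lo k := (\max_(t in T | (t : nat) < k) t.+1)%N.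
pose hi k := (r - \max_(t in T | k <= (t : nat)) (r - t.+1))%N.
have loP k (t : 'I_r.-1) : t \in T -> (t < k)%N -> (t.+1 <= lo k)%N.
  by move=> tT tk; rewrite /lo (bigD1 t) /= ?tT // leq_maxl.
have hiP k (t : 'I_r.-1) : t \in T -> (k <= t)%N -> (hi k <= t.+1)%N.
  move=> tT tk; have tr := ltn_ord t.
  suff : (r - t.+1 <= \max_(t in T | k <= (t : nat)) (r - t.+1))%N.
    by rewrite /hi; lia.
  by rewrite (bigD1 t) /= ?tT // leq_maxl.
have lok k : (lo k <= k)%N by apply/bigmax_leqP=> t /andP[].
have khi k : (k < r)%N -> (k.+1 <= hi k <= r)%N.
  move=> kr; rewrite /hi leq_subr andbT.
  suff : (\max_(t in T | k <= (t : nat)) (r - t.+1) <= r - k.+1)%N by lia.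
  by apply/bigmax_leqP=> t /andP[_ kt]; lia.
have lohi i j : (i <= j)%N -> (j < r)%N ->
    (lo i = lo j /\ hi i = hi j) \/
    ((hi i <= lo j)%N /\ exists2 t : 'I_r.-1, t \in T & (i <= t < j)%N).
  move=> ij jr.
  case: (pickP [pred t : 'I_r.-1 | (t \in T) && (i <= t < j)%N]).
    move=> t /= /andP[tT itj]; right; split; last by exists t.
    move: itj => /andP[it tj].
    exact: leq_trans (hiP _ _ tT it) (loP _ _ tT tj).
  move=> no; left; rewrite /lo /hi; split; last congr (_ - _)%N.
  - apply: eq_bigl => t; case tT: (t \in T) => //=.
    by have := no t; rewrite /= tT /=; lia.
  - apply: eq_bigl => t; case tT: (t \in T) => //=.
    by have := no t; rewrite /= tT /=; lia.
pose e := [tuple r%:Z - (lo k)%:Z - (hi k)%:Z | k < r].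
have eE k : (k < r)%N -> entry e k = r%:Z - (lo k)%:Z - (hi k)%:Z.
  move=> kr; have := tnth_nth 0 e (Ordinal kr); rewrite tnth_mktuple.
  by move=> ->.
clearbody e.
have strict i j : (i < j)%N -> (j < r)%N ->
    (hi i <= lo j)%N -> entry e i - entry e j > j%:Z - i%:Z.
  move=> ij jr hl; rewrite !eE ?(ltn_trans ij jr) //.
  by have := khi j jr; have := khi i (ltn_trans ij jr); have := lok i; lia.
have eP : in_E e.
  apply/in_EP; split=> [i j ij jr|i j ij jr|i ir].
  - case: (lohi i j ij jr) => [[el eh]|[hl [t _ itj]]].
      by rewrite !eE ?el ?eh ?(leq_ltn_trans ij jr).
    have ltij : (i < j)%N by lia.
    by have := strict i j ltij jr hl; lia.
  - case: (lohi i j (ltnW ij) jr) => [[el eh]|[hl _]].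
      by rewrite !eE ?el ?eh ?(ltn_trans ij jr) //; lia.
    by have := strict i j ij jr hl; lia.
  - by rewrite eE //; have := lok i; have := khi i ir; lia.
exists (exist _ e eP); apply/eqP/setP=> t; rewrite inE /=.
have tr : (t.+1 < r)%N by have := ltn_ord t; lia.
case: (lohi t t.+1 (leqnSn t) tr) => [[el eh]|[hl [u uT tu]]].
  rewrite !eE ?(ltnW tr) // el eh ltxx; apply/esym/negP=> tT.
  by have := loP t.+1 t tT (ltnSn t); have := lok t; lia.
have -> : t = u by apply: val_inj => /=; lia.
rewrite uT; have ut : u = t :> nat by lia.
by rewrite ut; have := strict t t.+1 (ltnSn t) tr hl; lia.
Qed.

Lemma in_E_gap (e : r.-tuple int) i j : in_E e -> (i < j)%N -> (j < r)%N ->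
  entry e i = entry e j \/ entry e i - entry e j > j%:Z - i%:Z.
Proof.
move=> /in_EP[h1 h2 _]; elim: j => // j IHj ij jr.
have jr' : (j < r)%N := ltnW jr.
have [ej|gt] : entry e i = entry e j \/ (i < j)%N /\ entry e i - entry e j > j%:Z - i%:Z.
- case: (ltngtP i j) => [lt_ij|ji|->]; [|by lia|by left].
  by case: (IHj lt_ij jr'); [left|right].
- have eqi k : (i <= k)%N -> (k <= j)%N -> entry e k = entry e j.
    move=> ik kj; have := h1 k j kj jr'; have := h1 i k ik.
    by move=> /(_ (leq_ltn_trans kj jr')); lia.
  case: (eqVneq (entry e i) (entry e j.+1)) => [|ne]; [by left | right].
  have lt : entry e (j.+1) < entry e i by rewrite lt_neqAle eq_sym ne h1 // ltnW.
  case: (ltrP (j.+1%:Z - i%:Z) (entry e i - entry e (j.+1))) => // le.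
  pose d := `|entry e i - entry e (j.+1)|%N.
  have dE : d%:Z = entry e i - entry e (j.+1) by rewrite /d; lia.
  have := h2 (j.+1 - d)%N j.+1; rewrite (eqi (j.+1 - d)%N); [|lia|lia].
  by rewrite -ej => /(_ _ jr); lia.
by have := h1 j j.+1 (leqnSn j) jr; have := h2 i j.+1 ij jr; right; lia.
Qed.

Lemma Phi_ET_eq (e : Eset) i j : (i <= j)%N -> (j < r)%N ->
  (entry (val e) i == entry (val e) j) =
  [forall t : 'I_r.-1, (i <= t < j)%N ==> (t \notin Phi_ET e)].
Proof.
move=> ij jr; have /in_EP[h1 _ _] := valP e.
apply/eqP/forallP => [eij t|noT].
  apply/implyP=> /andP[it tj]; rewrite inE -leNgt.
  have := h1 t.+1 j tj jr; have := h1 i t it.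
  by move=> /(_ (ltn_trans tj jr)); lia.
elim: j ij jr noT => [|j IHj]; first by rewrite leqn0 => /eqP->.
rewrite leq_eqVlt => /orP[/eqP-> //|]; rewrite ltnS => ij jr noT.
have tr : (j < r.-1)%N by lia.
rewrite (IHj ij (ltnW jr)); last first.
  by move=> t; apply/implyP=> itj; apply: (implyP (noT t)); lia.
have le : entry (val e) j <= entry (val e) j.+1.
  have := implyP (noT (Ordinal tr)); rewrite inE -leNgt; apply.
  by rewrite ij /=.
have := h1 j j.+1 (leqnSn j) jr; lia.
Qed.

Lemma Phi_ET_inj : injective Phi_ET.
Proof.
have fP (e : Eset) (i : 'I_r) : (absz (r.-1%:Z - i%:Z - entry (val e) i)%R < r)%N.
  have /in_EP[_ _ /(_ i (ltn_ord i))] := valP e.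
  by have := ltn_ord i; lia.
pose f e i : 'I_r := Ordinal (fP e i).
have fE (e : Eset) i : (f e i)%:Z = r.-1%:Z - i%:Z - entry (val e) i.
  have /in_EP[_ _ /(_ i (ltn_ord i))] := valP e.
  by rewrite /=; have := ltn_ord i; lia.
clearbody f.
have f_lt (e : Eset) (i j : 'I_r) : (i < j)%N ->
    (f e i < f e j)%N = (entry (val e) i != entry (val e) j).
  move=> ij; have := fE e i; have := fE e j.
  by case: (in_E_gap (valP e) ij (ltn_ord j)); lia.
have f_inj (e : Eset) : injective (f e).
  move=> i j fij; apply: val_inj.
  have := fE e i; rewrite fij fE => eij.
  case: (ltngtP i j) => // ij.
    by case: (in_E_gap (valP e) ij (ltn_ord j)) eij; lia.
  by case: (in_E_gap (valP e) ij (ltn_ord i)) eij; lia.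
have f_card (e : Eset) i : val (f e i) = #|[set j | (f e j < f e i)%N]|.
  have -> : [set j | (f e j < f e i)%N] =
            f e @^-1: [set k : 'I_r | (k < f e i)%N].
    by apply/setP=> j; rewrite !inE.
  rewrite on_card_preimset; last first.
    have [g fK gK] := injF_bij (f_inj e).
    by exists g => x _; [apply: fK | apply: gK].
  rewrite cardsE -sum1_card (big_ord_narrow (ltnW (ltn_ord (f e i)))).
  by rewrite sum_nat_const card_ord muln1.
move=> e e' eT; apply: val_inj; apply: eq_from_tnth => i.
have eqE (j k : 'I_r) : (j <= k)%N ->
    (entry (val e) j == entry (val e) k) = (entry (val e') j == entry (val e') k).
  by move=> jk; rewrite !Phi_ET_eq ?eT.
suff fii : f e i = f e' i.
  rewrite !(tnth_nth 0) -!/(entry _ _).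
  by have := fE e i; rewrite fii fE; lia.
apply: val_inj; rewrite (f_card e) (f_card e'); apply: eq_card => j; rewrite !inE.
case: (ltngtP j i) => [ji|ij|/val_inj->]; last by rewrite !ltnn.
  by rewrite !f_lt // eqE // ltnW.
have ne (e0 : Eset) : (f e0 j < f e0 i)%N = ~~ (f e0 i < f e0 j)%N.
  rewrite -leqNgt ltn_neqAle andb_idl // => _; apply/eqP=> /val_inj/f_inj ji.
  by rewrite ji ltnn in ij.
by rewrite !ne !f_lt // eqE // ltnW.
Qed.

Definition Phi_TE (T : {set 'I_r.-1}) : Eset := xchoose (Phi_ET_surj T).

Lemma Phi_TEK : cancel Phi_TE Phi_ET.
Proof. by move=> T; apply/eqP; apply: (xchooseP (Phi_ET_surj T)). Qed.

Lemma Phi_ETK : cancel Phi_ET Phi_TE.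
Proof. by move=> e; apply: Phi_ET_inj; rewrite Phi_TEK. Qed.

End EpsilonSequences.

(* Main.v *)
From HB Require Import structures.
Require Import Defs.
From mathcomp Require Import all_boot all_order all_fingroup all_algebra.
From mathcomp Require Import mxtens zify ring boolp.

Set Implicit Arguments.
Unset Strict Implicit.
Unset Printing Implicit Defensive.

Import Order.TTheory GRing.Theory Num.Theory.
Local Open Scope ring_scope.

(* With x = N_r (x) 1 and y = (1 (x) N_s)(1 + x), the nilpotent part of
   J_r (x) J_s is u = x + y acting on the graded module V = F[x,y]/(x^r, y^s).
   Since V/uV = F[x]/(x^r), there is one string of u starting in each degree
   d = 0, ..., r-1; its length lambda_(d+1) is the least m such that u^m q = 0 for
   some form q of degree d outside uV.  Multiplying q by x shows that lambda is
   decreasing, and as the kernel of u is at most one-dimensional in each degree,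
   the strings end in different degrees, i.e. the numbers lambda_n + n are
   distinct; these are the conditions defining the set E.
   In the monomial bases, D_n is the determinant of u^(r+s-2n) from degree n-1 to
   degree r+s-n-1, so that p does not divide D_n iff each of the first n strings
   reaches degree r+s-n-1, that is, iff the n largest of the numbers lambda_i + i
   are those with i <= n, iff lambda_n > lambda_(n+1) (for n < r).  Between two
   consecutive such n, lambda is constant, and its value is read off the fact that
   the lambda_i + i fill an interval. *)

(** * Forms in two variables *)

Section Homogenization.
Variables (F : fieldType) (V : lmodType F) (A B : {linear V -> V}) (e : V).
Hypothesis commAB : forall v, A (B v) = B (A v).
Implicit Types f : {poly F}.

(* The value at (A, B), applied to e, of the form of degree m - 1 in (x, u) whose
   dehomogenization at u = 1 is f. *)
Definition homog (m : nat) (f : {poly F}) : V :=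
  \sum_(k < m) f`_k *: iter k A (iter (m - k.+1) B e).

Lemma homog_is_linear m : linear (homog m).
Proof.
move=> c f g; rewrite /homog scaler_sumr -big_split; apply: eq_bigr => k _.
by rewrite coefD coefZ scalerDl scalerA.
Qed.

HB.instance Definition _ m :=
  GRing.isLinear.Build F {poly F} V _ (homog m) (homog_is_linear m).

Lemma iter_comm k v : iter k A (B v) = B (iter k A v).
Proof. by elim: k => //= k ->. Qed.

Lemma homog_widen m f : (size f <= m)%N -> homog m.+1 f = B (homog m f).
Proof.
move=> fm; rewrite /homog big_ord_recr /= nth_default // scale0r addr0.
rewrite raddf_sum; apply: eq_bigr => k _ /=.
rewrite linearZ /= -iter_comm.
by have -> : (m.+1 - k.+1 = (m - k.+1).+1)%N by have := ltn_ord k; lia.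
Qed.

Lemma homog_mulX m f : homog m.+1 ('X * f) = A (homog m f).
Proof.
rewrite /homog big_ord_recl coefXM scale0r add0r raddf_sum.
by apply: eq_bigr => k _ /=; rewrite linearZ /= coefXM.
Qed.

Lemma homog_widenn n m f : (size f <= m)%N -> homog (m + n) f = iter n B (homog m f).
Proof.
move=> fm; elim: n => [|n IHn]; first by rewrite addn0.
by rewrite addnS homog_widen ?IHn // (leq_trans fm) ?leq_addr.
Qed.

Lemma homog_mulXn n m f : homog (m + n) ('X^n * f) = iter n A (homog m f).
Proof.
elim: n => [|n IHn]; first by rewrite addn0 mul1r.
by rewrite addnS exprS -mulrA homog_mulX IHn.
Qed.

Lemma size_linXn_le (c : F) n m f :
  (size f <= m)%N -> (size (((1 + c *: 'X) ^+ n * f)%R) <= m + n)%N.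
Proof.
move=> fm; elim: n => [|n IHn]; first by rewrite mul1r addn0.
rewrite exprS -mulrA mulrDl mul1r addnS (leq_trans (size_polyD _ _)) // geq_max.
rewrite (leq_trans IHn) ?leqnSn //= -scalerAl (leq_trans (size_scale_leq _ _)) //.
by rewrite mulrC (leq_trans (size_polyMleq _ _)) // size_polyX addn2.
Qed.

(** The polynomial 1 + c X dehomogenizes u + c x; the case c = -1 gives the action of y = u - x. *)
Lemma homog_mul_linXn (c : F) n m f : (size f <= m)%N ->
  homog (m + n) ((1 + c *: 'X) ^+ n * f) = iter n (fun v => B v + c *: A v) (homog m f).
Proof.
move=> fm; elim: n => [|n IHn]; first by rewrite mul1r addn0.
rewrite addnS exprS -mulrA mulrDl mul1r linearD /= -scalerAl linearZ /= homog_mulX.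
by rewrite homog_widen ?size_linXn_le // IHn.
Qed.

End Homogenization.

Arguments homog {F V} A B e m f.

(* The part of degree m - 1 of the homogeneous ideal (x^r, y^s) of F[x, y],
   written in the coordinates x and u = x + y and dehomogenized at u = 1. *)
Definition ideal_part (F : fieldType) (r s m : nat) (f : {poly F}) : Prop :=
  exists a b : {poly F}, [/\ (size a <= m - r)%N, (size b <= m - s)%N &
    f = 'X^r * a + (1 - 'X) ^+ s * b].

(** * The graded pieces of the ideal (x^r, y^s) *)

Section IdealPart.
Variables (F : fieldType) (r s : nat).
Hypothesis (le_rs : (r <= s)%N).
Implicit Types f g : {poly F}.

Local Notation W := (@ideal_part F r s).

Lemma ideal_part_mulX m f : W m f -> W m.+1 ('X * f).
Proof.
move=> [a [b [sa sb ->]]]; exists ('X * a), ('X * b).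
have sX d (q : {poly F}) : (size q <= m - d)%N -> (size ('X * q)%R <= m.+1 - d)%N.
  case: (eqVneq q 0) => [->|q0]; first by rewrite mulr0 size_poly0.
  by rewrite mulrC size_mulX //; have := size_poly_eq0 q; rewrite (negPf q0); lia.
by split; [exact: sX|exact: sX|rewrite mulrDr !(mulrCA 'X)].
Qed.

Lemma size_1subXn n : size ((1 - 'X) ^+ n : {poly F}) = n.+1.
Proof.
have -> : (1 - 'X : {poly F}) = - ('X - 1%:P) by rewrite opprB.
by rewrite exprNn size_Msign size_exp_XsubC.
Qed.

Lemma size_1subXnM n f : f != 0 -> size ((1 - 'X) ^+ n * f) = (n + size f)%N.
Proof.
by move=> f0; rewrite size_mul ?size_1subXn // -size_poly_gt0 size_1subXn.
Qed.

Lemma size_XnM n f : f != 0 -> size ('X^n * f) = (n + size f)%N.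
Proof. by move=> f0; rewrite mulrC size_mulXn. Qed.

Lemma size0_eq0 f m : (size f <= m)%N -> m = 0%N -> f = 0.
Proof. by move=> + m0; rewrite m0 leqn0 size_poly_eq0 => /eqP. Qed.

Lemma ideal_part_ltr m f : (m <= s)%N -> W m f -> (size f <= r)%N -> f = 0.
Proof.
move=> ms [a [b [sa sb ->]]]; rewrite (size0_eq0 sb) ?mulr0 ?addr0; last by lia.
case: (eqVneq a 0) => [->|a0]; first by rewrite mulr0.
by rewrite size_XnM //; have := size_poly_eq0 a; rewrite (negPf a0); lia.
Qed.

(** Bezout for X^r and (1 - X)^s: the cofactor [b] is reduced modulo X^r, and comparing sizes then
    bounds [a]. Hence V vanishes in degree r + s - 1. *)
Lemma ideal_part_top f : (size f <= r + s)%N -> W (r + s) f.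
Proof.
move=> sf.
have cop : coprimep ('X^r : {poly F}) ((1 - 'X) ^+ s).
  rewrite coprimep_expl // coprimep_expr //.
  have -> : (1 - 'X : {poly F}) = - ('X - 1%:P) by rewrite opprB.
  rewrite -scaleN1r coprimepZr ?oppr_eq0 ?oner_neq0 //.
  by rewrite coprimep_XsubC rootX oner_eq0.
have /Bezout_eq1_coprimepP [[u v] /= uv1] := cop.
pose b := (v * f) %% 'X^r; pose q := (v * f) %/ 'X^r.
have sb : (size b <= r)%N.
  by rewrite -ltnS -[X in (_ < X)%N](size_polyXn F r) ltn_modp -size_poly_eq0 size_polyXn.
have fE : f = 'X^r * (u * f + q * (1 - 'X) ^+ s) + (1 - 'X) ^+ s * b.
  have vf : v * f = q * 'X^r + b by apply: divp_eq.
  transitivity (u * f * 'X^r + v * f * (1 - 'X) ^+ s); last by rewrite vf; ring.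
  by rewrite -[LHS]mul1r -[X in X * f]uv1; ring.
exists (u * f + q * (1 - 'X) ^+ s), b.
move: fE; set a := u * f + _ => fE.
split => //; last by rewrite addnK.
case: (eqVneq a 0) => [->|a0]; first by rewrite size_poly0.
rewrite addKn -(leq_add2l r) -size_XnM //.
have -> : 'X^r * a = f - (1 - 'X) ^+ s * b by rewrite {1}fE addrK.
rewrite (leq_trans (size_polyD _ _)) // geq_max sf size_polyN.
case: (eqVneq b 0) => [->|b0]; first by rewrite mulr0 size_poly0.
by rewrite size_1subXnM // addnC leq_add2r.
Qed.

(** Only [b] has to be bounded: X^r a is then a difference of polynomials of sizes at most r and m,
    which bounds [a]. *)
Lemma ideal_part_shrink m (a b : {poly F}) : (s <= m)%N -> (size b <= m - s)%N ->
  (size ('X^r * a + (1 - 'X) ^+ s * b)%R <= r)%N ->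
  W m ('X^r * a + (1 - 'X) ^+ s * b).
Proof.
move=> sm sb sf; exists a, b; split => //.
case: (eqVneq a 0) => [->|a0]; first by rewrite size_poly0.
have : (size ('X^r * a)%R <= maxn r m)%N.
  rewrite -['X^r * a](addrK ((1 - 'X) ^+ s * b)).
  rewrite (leq_trans (size_polyD _ _)) // geq_max size_polyN.
  rewrite (leq_trans sf) ?leq_maxl //=.
  case: (eqVneq b 0) => [->|b0]; first by rewrite mulr0 size_poly0.
  by rewrite size_1subXnM //; have := size_poly_eq0 b; rewrite (negPf b0); lia.
by rewrite size_XnM //; have := size_poly_eq0 a; rewrite (negPf a0); lia.
Qed.

(** The kernel of u is at most one-dimensional in each degree: by [ideal_part_shrink], passing from
    [m.+1] to [m] costs a single linear condition, the vanishing of the coefficient of index m - s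
    in [b]. If it fails for [f], a multiple of [f] corrects [g] without changing its size. *)
Lemma ideal_part_lead m f g : (s <= m)%N ->
  W m.+1 f -> W m.+1 g -> (size f < size g <= r)%N ->
  W m f \/ exists2 h, W m h & size h = size g.
Proof.
move=> sm [a [b [sa sb fE]]] [a' [b' [sa' sb' gE]]] /andP[sfg sgr].
have sm1 : (m.+1 - s = (m - s).+1)%N by lia.
rewrite sm1 in sb sb'.
case: (eqVneq b`_(m - s) 0) => [b0|b0].
  left; rewrite fE; apply: ideal_part_shrink => //; last by rewrite -fE; lia.
  apply/leq_sizeP => j; rewrite leq_eqVlt => /predU1P[<- //|jm].
  by apply: nth_default; apply: leq_trans sb jm.
right; pose c := - (b'`_(m - s) / b`_(m - s)).
have shE : size (g + c *: f) = size g.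
  by rewrite size_polyDl // (leq_ltn_trans (size_scale_leq _ _)).
exists (g + c *: f) => //.
have hE : g + c *: f = 'X^r * (a' + c *: a) + (1 - 'X) ^+ s * (b' + c *: b).
  by rewrite fE gE !mulrDr scalerDr -!scalerAr addrACA.
rewrite hE; apply: ideal_part_shrink => //; last by rewrite -hE shE.
apply/leq_sizeP => j; rewrite leq_eqVlt => /predU1P[<-|jm].
  by rewrite coefD coefZ mulNr divfK ?subrr.
by apply: nth_default; rewrite (leq_trans (size_polyD _ _)) // geq_max;
  rewrite (leq_trans sb' jm) (leq_trans (size_scale_leq _ _)) // (leq_trans sb jm).
Qed.

Lemma ideal_part_exists d : (d < r)%N ->
  exists m, `[< exists2 f, W m f & size f = d.+1 >].
Proof.
move=> dr; exists (r + s)%N; apply/asboolP; exists 'X^d; last by rewrite size_polyXn.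
by apply: ideal_part_top; rewrite size_polyXn; lia.
Qed.

(* The string of u that starts in degree d of F[x, y] / (x^r, y^s) reaches 0 in
   degree ideal_start d - 1. *)
Definition ideal_start (d : 'I_r) : nat := ex_minn (ideal_part_exists (ltn_ord d)).

Lemma ideal_startP (d : 'I_r) : exists2 f, W (ideal_start d) f & size f = d.+1.
Proof. by rewrite /ideal_start; case: ex_minnP => m /asboolP. Qed.

Lemma ideal_start_min (d : 'I_r) m f : W m f -> size f = d.+1 -> (ideal_start d <= m)%N.
Proof.
move=> Wf sf; rewrite /ideal_start; case: ex_minnP => k _; apply.
by apply/asboolP; exists f.
Qed.

Lemma ideal_start_le d : (ideal_start d <= r + s)%N.
Proof.
apply: (@ideal_start_min d _ 'X^d); last by rewrite size_polyXn.
by apply: ideal_part_top; rewrite size_polyXn; have := ltn_ord d; lia.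
Qed.

Lemma ideal_start_gt d : (s < ideal_start d)%N.
Proof.
have [f Wf sf] := ideal_startP d; rewrite ltnNge; apply/negP => le.
have := ideal_part_ltr le Wf; rewrite sf ltn_ord => /(_ isT) f0.
by rewrite f0 size_poly0 in sf.
Qed.

(** If two strings reached 0 in the same degree, [ideal_part_lead] would contradict the minimality
    of one of them. *)
Lemma ideal_start_inj : injective ideal_start.
Proof.
have key (i j : 'I_r) : (i < j)%N -> ideal_start i <> ideal_start j.
  move=> ij eq_ij; have [f Wf sf] := ideal_startP i; have [g Wg sg] := ideal_startP j.
  have gt := ideal_start_gt j.
  rewrite eq_ij in Wf; rewrite -(ltn_predK gt) in Wf Wg.
  have sfg : (size f < size g <= r)%N by rewrite sf sg ltnS ij ltn_ord.
  have [|Wf'|[h Wh sh]] := ideal_part_lead _ Wf Wg sfg; first by lia.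
    by have := ideal_start_min Wf' sf; lia.
  by rewrite sg in sh; have := ideal_start_min Wh sh; lia.
move=> i j eq_ij; apply: val_inj; case: (ltngtP i j) => // /key; last by rewrite eq_ij.
by move/(_ eq_ij).
Qed.

Lemma ideal_start_succ (i j : 'I_r) : j = i.+1 :> nat ->
  (ideal_start j <= (ideal_start i).+1)%N.
Proof.
move=> ji; have [f Wf sf] := ideal_startP i.
apply: (@ideal_start_min j _ ('X * f)); first exact: ideal_part_mulX.
by rewrite mulrC size_mulX -?size_poly_gt0 sf ?ji.
Qed.

(** By injectivity the values fill the interval from s + 1 to s + r. *)
Lemma sum_ideal_start : (\sum_d ideal_start d = \sum_(d < r) (s + d.+1))%N.
Proof.
have hP d : (ideal_start d - s.+1 < r)%N.
  by have := ideal_start_le d; have := ideal_start_gt d; lia.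
pose h d := Ordinal (hP d).
have h_inj : injective h.
  move=> i j [] eq_ij; apply: ideal_start_inj.
  by have := ideal_start_gt i; have := ideal_start_gt j; lia.
rewrite [RHS](reindex_inj h_inj) /=; apply: eq_bigr => d _.
by have := ideal_start_gt d; lia.
Qed.

(* An element of degree t - 1 in the kernel of u ^ (r + s - 2 t). *)
Definition sing_at t := exists2 v, W (r + s - t) v & v != 0 /\ (size v <= t)%N.

Lemma sing_atP t : (t <= r)%N ->
  sing_at t <-> exists2 d : 'I_r, (d < t)%N & (ideal_start d <= r + s - t)%N.
Proof.
move=> tr; split=> [[v Wv [v0 sv]]|[d dt le]].
  have sv0 : (0 < size v)%N by rewrite size_poly_gt0.
  have dr : ((size v).-1 < r)%N by rewrite prednK // (leq_trans sv).
  exists (Ordinal dr) => /=; first by rewrite prednK.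
  by apply: ideal_start_min Wv _; rewrite /= prednK.
have [f Wf sf] := ideal_startP d.
exists f; last by rewrite -size_poly_gt0 sf; split.
move: Wf => [a [b [sa sb fE]]]; exists a, b; split => //.
  by rewrite (leq_trans sa) ?leq_sub2r.
by rewrite (leq_trans sb) ?leq_sub2r.
Qed.

End IdealPart.

(** * Changes of coordinates and the determinants D_n *)

Section ChangeOfCoordinates.
Variable F : fieldType.
Implicit Types (c : F) (f : {poly F}).

Definition mull (a : {poly F}) : {linear {poly F} -> {poly F}} := a \*o idfun.

(* Writes the homogeneous polynomial of degree m - 1 with dehomogenization f in
   the coordinates x and y + c x, dehomogenized at y = 1. *)
Definition shear c (m : nat) f : {poly F} :=
  homog (mull 'X) (mull (1 + c *: 'X)) 1 m f.

Lemma mull_comm (a b v : {poly F}) : mull a (mull b v) = mull b (mull a v).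
Proof. exact: mulrCA. Qed.

HB.instance Definition _ c m :=
  GRing.isLinear.Build F {poly F} {poly F} _ (shear c m) (@homog_is_linear F _ _ _ _ m).

Lemma iter_mull (a v : {poly F}) n : iter n (mull a) v = a ^+ n * v.
Proof. by elim: n => [|n IHn] /=; rewrite ?mul1r // IHn exprS mulrA. Qed.

Lemma shear_mulXn c n m f : shear c (m + n) ('X^n * f) = 'X^n * shear c m f.
Proof. by rewrite /shear homog_mulXn iter_mull. Qed.

Lemma shear_widen c n m f : (size f <= m)%N ->
  shear c (m + n) f = (1 + c *: 'X) ^+ n * shear c m f.
Proof. by move=> fm; rewrite /shear homog_widenn ?iter_mull //; apply: mull_comm. Qed.

(** The form y - c x becomes (1 + c X) - c X = 1, so its powers disappear. *)
Lemma shear_mulVn c n m f : (size f <= m)%N ->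
  shear c (m + n) ((1 - c *: 'X) ^+ n * f) = shear c m f.
Proof.
move=> fm; rewrite /shear -scaleNr homog_mul_linXn //; last exact: mull_comm.
elim: n => //= n ->; rewrite scaleNr mulrDl mul1r -scalerAl.
by rewrite addrK.
Qed.

Lemma size_shear c m f : (size (shear c m f) <= m)%N.
Proof.
rewrite /shear /homog; apply: (big_ind (fun p : {poly F} => (size p <= m)%N)).
- by rewrite size_poly0.
- by move=> p q sp sq; rewrite (leq_trans (size_polyD _ _)) // geq_max sp.
move=> k _; rewrite (leq_trans (size_scale_leq _ _)) // !iter_mull mulr1.
have le1 : (size (1%R : {poly F}) <= 1)%N by rewrite size_poly1.
have := size_linXn_le c (m - k.+1) le1; rewrite mulr1.
set g := _ ^+ _ => sg; case: (eqVneq g 0) => [->|g0].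
  by rewrite mulr0 size_poly0.
rewrite mulrC size_mulXn //; have := ltn_ord k.
by move: sg; move: (size g) => l; lia.
Qed.

Lemma shearK c m f : (size f <= m)%N -> shear (- c) m (shear c m f) = f.
Proof.
move=> fm; rewrite {2}/shear /homog linear_sum -[RHS]coefK (poly_def (size f)).
rewrite (big_ord_widen _ (fun k => f`_k *: 'X^k) fm); apply/esym.
rewrite big_mkcond; apply: eq_bigr => k _; rewrite linearZ /= !iter_mull mulr1.
have -> : shear (- c) m ('X^k * (1 + c *: 'X) ^+ (m - k.+1)) = 'X^k.
  have {1}-> : m = ((1 + (m - k.+1)) + k)%N by have := ltn_ord k; lia.
  rewrite shear_mulXn -[in (1 + c *: _)](opprK c) scaleNr -[_ ^+ (m - k.+1)]mulr1.
  rewrite shear_mulVn ?size_poly1 //.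
  by rewrite /shear /homog big_ord1 coef1 eqxx scale1r !mulr1.
by case: ltnP => // le; rewrite nth_default ?scale0r.
Qed.

End ChangeOfCoordinates.

(** By symmetry the binomial is C(N, r - t + j - i) with N = r + s - 2t. Row i of the matrix thus
    holds the coefficients of index r - t to r - 1 of u^N times a monomial of degree t - 1, written
    at y = 1. *)
Lemma binz_intr (F : fieldType) (r s t i j : nat) : (t <= r)%N -> (r <= s)%N ->
  (i < t)%N -> (j < t)%N ->
  (binz (s + r - 2 * t) (s%:Z - t%:Z + i%:Z - j%:Z))%:~R =
  ('X^i * (1 + 'X) ^+ (s + r - 2 * t))`_(r - t + j) :> F.
Proof.
move=> tr rs it jt; rewrite coefXnM; set N := (s + r - 2 * t)%N.
have coefN k : ((1 + 'X : {poly F}) ^+ N)`_k = 'C(N, k)%:R.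
  rewrite addrC exprD1n coef_sum; case: (ltnP k N.+1) => kN.
    rewrite (bigD1 (Ordinal kN)) //= coefMn coefXn eqxx big1 ?addr0 // => l lk.
    by rewrite coefMn coefXn; case: (eqVneq k l) lk => [kl /eqP[]|_ _];
      [exact: val_inj | rewrite mul0rn].
  rewrite big1 ?bin_small // => l _; rewrite coefMn coefXn.
  case: eqVneq kN => [->|_ _]; last by rewrite mul0rn.
  by rewrite leqNgt ltn_ord.
(* Both sides vanish when the lower index on the left exceeds N (this case) or is negative (the last
   case). *)
rewrite coefN; case: (ltnP (r - t + j) i) => ij.
  have -> : s%:Z - t%:Z + i%:Z - j%:Z = (s - t + i - j)%N%:Z by lia.
  by rewrite /= bin_small // /N; lia.
case: (leqP j (s - t + i)) => ji.
  have -> : s%:Z - t%:Z + i%:Z - j%:Z = (s - t + i - j)%N%:Z by lia.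
  rewrite /= -bin_sub; last by rewrite /N; lia.
  by congr ('C(_, _)%:R); rewrite /N; lia.
have -> : s%:Z - t%:Z + i%:Z - j%:Z = Negz (j - (s - t + i)).-1 by lia.
by rewrite bin_small // /N; lia.
Qed.

(** A vector in the left kernel of the matrix is a form g of degree t - 1 such that u^N g has no
    monomial x^i y^j with i < r and j < s, so that u^N g lies in the ideal. The shears by 1 and -1
    pass between the coordinates (x, y) and (x, u). *)
Lemma delta_sing (F : fieldType) (p r s t : nat) : p \in [pchar F] ->
  (t <= r)%N -> (r <= s)%N -> delta r s p t <-> ~ sing_at F r s t.
Proof.
move=> charF tr rs; rewrite /delta (dvdz_pcharf charF) /Ddet.
set N := (s + r - 2 * t)%N; rewrite -det_map_mx; set M := map_mx _ _.
have cM (c : 'rV[F]_t) (j : 'I_t) : (c *m M) 0 j = (rVpoly c * (1 + 'X) ^+ N)`_(r - t + j).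
  rewrite [rVpoly c](poly_def t) mulr_suml coef_sum mxE; apply: eq_bigr => i _.
  rewrite !mxE -scalerAl coefZ valK; congr (_ * _).
  exact: binz_intr.
have tN : (r + s - t = t + N)%N by rewrite /N; lia.
have sN1 (f : {poly F}) : (size f <= t)%N -> (size (f * (1 + 'X) ^+ N)%R <= t + N)%N.
  by rewrite mulrC -['X]scale1r => /size_linXn_le; apply.
suff : \det M == 0 <-> sing_at F r s t by case: (\det M == 0) => -[h1 h2]; split; auto.
split=> [/det0P[c c0 /rowP cM0]|[v Wv [v0 sv]]].
  have sg : (size (rVpoly c) <= t)%N := size_poly _ _.
  have g0 : rVpoly c != 0 by apply: contraNneq c0 => e; rewrite -[c]rVpolyK e linear0.
  move: (rVpoly c) sg g0 (fun j => etrans (esym (cM c j)) (cM0 j)) => g sg g0 h0.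
  exists (shear (-1) t g); last first.
    split; last exact: size_shear.
    by apply: contraNneq g0 => e; rewrite -[g](shearK (-1) sg) e linear0.
  set h := g * _ in h0.
  (* The factor (1 + X)^N is u^N, which is lost when u is set to 1. *)
  have -> : shear (-1) t g = shear (-1) (r + s - t) h.
    have -> : h = (1 - (-1) *: 'X) ^+ N * g by rewrite mulrC scaleNr scale1r opprK.
    by rewrite tN shear_mulVn.
  (* Coefficients from index r on give the multiple of x^r. The others vanish in the window from r -
     t to r - 1, so what remains has y-exponent at least s. *)
  exists (shear (-1) (r + s - t - r) (drop_poly r h)),
         (shear (-1) (r + s - t - s) (take_poly r h)).
  rewrite !size_shear; split=> //.
  have st : (size (take_poly r h) <= r + s - t - s)%N.
    apply/leq_sizeP => j jt; rewrite coef_take_poly; case: ltnP => // jr.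
    have jt' : (j - (r - t) < t)%N by lia.
    have := h0 (Ordinal jt'); rewrite mxE /= subnKC //; last by lia.
  rewrite -{1}[h](poly_take_drop r) linearD /= addrC; congr (_ + _).
    have {1}-> : (r + s - t = r + s - t - r + r)%N by lia.
    by rewrite mulrC shear_mulXn.
  have {1}-> : (r + s - t = r + s - t - s + s)%N by lia.
  by rewrite shear_widen // scaleN1r.
apply/det0P; pose g := shear 1 t v.
have sg : (size g <= t)%N := size_shear _ _ _.
exists (poly_rV g).
  apply: contraNneq v0 => /(congr1 rVpoly); rewrite poly_rV_K // linear0 => e.
  by rewrite -[v](shearK 1 sv) -/g e linear0.
apply/rowP => j; rewrite cM poly_rV_K // mxE.
have -> : g * (1 + 'X) ^+ N = shear 1 (r + s - t) v.
  by rewrite tN shear_widen // scale1r mulrC.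
(* The multiple of x^r contributes only from index r on, that of y^s only below r - t: the window is
   empty. *)
move: Wv => [a [b [sa sb ->]]]; rewrite linearD coefD /=.
have {1}-> : (r + s - t = r + s - t - r + r)%N by lia.
rewrite shear_mulXn coefXnM.
have -> : (r - t + j < r)%N by have := ltn_ord j; lia.
rewrite add0r; have -> : (r + s - t = r + s - t - s + s)%N by lia.
have -> : 1 - 'X = 1 - 1 *: 'X :> {poly F} by rewrite scale1r.
rewrite shear_mulVn //.
by apply: nth_default; rewrite (leq_trans (size_shear _ _ _)) //; lia.
Qed.

(** * The Jordan form of the tensor product *)

Section NilpotentBlocks.
Variable F : fieldType.

Lemma nil_blockX l k : (nil_block F l) ^+ k = \matrix_(i, j) (j == i + k :> nat)%N%:R.
Proof.
elim: k => [|k IHk].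
  by apply/matrixP => i j; rewrite expr0 !mxE addn0 eq_sym.
rewrite exprSr IHk; apply/matrixP => i j; rewrite !mxE.
case: (ltnP (i + k) l) => ik; last first.
  rewrite big1 => [|h _]; rewrite ?mxE.
    by case: eqP => //; have := ltn_ord j; lia.
  by have := ltn_ord h; case: eqP => [->|_ _]; [lia | rewrite mul0r].
rewrite (bigD1 (Ordinal ik)) //= big1 => [|h hn].
  by rewrite ?mxE eqxx mul1r addr0 addnS.
rewrite ?mxE; case: eqP => [e|_]; last by rewrite mul0r.
by case/eqP: hn; apply: val_inj.
Qed.

Lemma tensmxX m n (A : 'M[F]_m) (B : 'M[F]_n) k : (A *t B) ^+ k = A ^+ k *t B ^+ k.
Proof.
elim: k => [|k IHk]; last by rewrite !exprS IHk -!mulmxE tensmx_mul.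
rewrite !expr0 -!idmxE; apply/matrixP => i j.
case: (mxtens_indexP i) => i1 i2; case: (mxtens_indexP j) => j1 j2.
rewrite tensmxE !mxE (can_eq (@mxtens_indexK _ _)) xpair_eqE.
by case: (i1 == j1); case: (i2 == j2); rewrite ?mul1r ?mul0r.
Qed.

Lemma iter_mulmxr n (X : 'M[F]_n) (v : 'rV_n) k : iter k (mulmxr X) v = v *m X ^+ k.
Proof.
elim: k => [|k IHk] /=; first by rewrite expr0 -idmxE mulmx1.
by rewrite IHk exprSr -mulmxE mulmxA.
Qed.

End NilpotentBlocks.

Section TensorProduct.
Variables (F : fieldType) (r s : nat).
Hypotheses (r_gt0 : (0 < r)%N) (le_rs : (r <= s)%N).

Local Notation N := (r * s)%N.
Local Notation start := (ideal_start F le_rs).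

Let s_gt0 : (0 < s)%N := leq_trans r_gt0 le_rs.

(* J_r (x) J_s = (1 + X) (1 + Y') = 1 + U with U = X + Y and Y = Y' (1 + X). *)
Let X : 'M[F]_N := nil_block F r *t 1%:M.
Let Y' : 'M[F]_N := 1%:M *t nil_block F s.
Let U : 'M[F]_N := (1 + X) * (1 + Y') - 1.
Let Y : 'M[F]_N := Y' * (1 + X).
(** The class of 1 in V; matrices act on row vectors from the right. *)
Let e : 'rV[F]_N := delta_mx 0 (mxtens_index (Ordinal r_gt0, Ordinal s_gt0)).

Let tens11 : 1%:M *t 1%:M = 1 :> 'M[F]_N.
Proof. by have := tensmxX (1 : 'M[F]_r) (1 : 'M[F]_s) 0; rewrite !expr0 -!idmxE. Qed.

Let jordan_tensE : jordan_block F r *t jordan_block F s = 1 + U.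
Proof.
rewrite addrC subrK -tens11 /X /Y'.
have -> : 1%:M *t 1%:M + nil_block F r *t 1%:M = jordan_block F r *t (1%:M : 'M_s).
  by apply/matrixP => i j; rewrite !mxE mulrDl.
have -> : 1%:M *t 1%:M + 1%:M *t nil_block F s = (1%:M : 'M_r) *t jordan_block F s.
  by apply/matrixP => i j; rewrite !mxE mulrDr.
by rewrite -mulmxE tensmx_mul mul1mx mulmx1.
Qed.

Let commXY' : X * Y' = Y' * X.
Proof. by rewrite /X /Y' -mulmxE !tensmx_mul !mul1mx !mulmx1. Qed.

Let UXY : U = X + Y.
Proof.
by rewrite /U /Y mulrDr mulr1 addrAC [1 + X]addrC addrK addrC mulrDr mulr1 mulrDl
  mul1r commXY' addrC.
Qed.

Let commXY : X * Y = Y * X.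
Proof. by rewrite /Y mulrDr mulr1 mulrDr mulrDl !mulrA !commXY'. Qed.

Let commXU (v : 'rV[F]_N) : mulmxr X (mulmxr U v) = mulmxr U (mulmxr X v).
Proof. by rewrite /= -!mulmxA !mulmxE UXY mulrDl mulrDr commXY. Qed.

Let X_nil : X ^+ r = 0.
Proof.
rewrite /X tensmxX nil_blockX; apply/matrixP => i j; rewrite !mxE.
set i1 := (mxtens_unindex i).1; set j1 := (mxtens_unindex j).1.
have -> : (j1 == i1 + r :> nat)%N = false by have := ltn_ord j1; lia.
by rewrite mul0r.
Qed.

Let Y'_nil : Y' ^+ s = 0.
Proof.
rewrite /Y' tensmxX nil_blockX; apply/matrixP => i j; rewrite !mxE.
set i1 := (mxtens_unindex i).2; set j1 := (mxtens_unindex j).2.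
have -> : (j1 == i1 + s :> nat)%N = false by have := ltn_ord j1; lia.
by rewrite mulr0.
Qed.

Let Y_nil : Y ^+ s = 0.
Proof.
rewrite /Y exprMn_comm ?Y'_nil ?mul0r //.
by rewrite /GRing.comm mulrDl mulrDr mul1r mulr1 commXY'.
Qed.

Local Notation H := (homog (mulmxr X) (mulmxr U) e).

(** X^r = 0 kills the first summand; 1 - X dehomogenizes y = u - x, which acts as Y, and Y^s = 0. *)
Let H_ideal m f : ideal_part r s m f -> H m f = 0.
Proof.
move=> [a [b [sa sb ->]]]; rewrite linearD /=.
have -> : H m ('X^r * a) = 0.
  case: (leqP r m) => rm.
    by rewrite -(subnK rm) homog_mulXn iter_mulmxr X_nil mulmx0.
  by rewrite (size0_eq0 sa) ?mulr0 ?linear0 //; lia.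
rewrite add0r; case: (leqP s m) => sm; last first.
  by rewrite (size0_eq0 sb) ?mulr0 ?linear0 //; lia.
rewrite -(subnK sm) -['X]scale1r -scaleNr homog_mul_linXn //.
have E n (v : 'rV[F]_N) :
    iter n (fun v => mulmxr U v + (-1) *: mulmxr X v) v = v *m Y ^+ n.
  rewrite -iter_mulmxr; apply: eq_iter => w /=.
  by rewrite scaleN1r -mulmxBr UXY addrC addKr.
by rewrite E Y_nil mulmx0.
Qed.

Variables (lam : r.-tuple nat) (q : 'I_r -> {poly F}).
Hypothesis lamE : forall d : 'I_r, tnth lam d = (start d - d.+1)%N.
Hypothesis qW : forall d, ideal_part r s (start d) (q d).
Hypothesis size_q : forall d : 'I_r, size (q d) = d.+1.

(** The string of [q d]: raising the degree applies U, so row k is U^k applied to [q d] taken in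
    degree d. *)
Let C (d : 'I_r) : 'M[F]_(tnth lam d, N) := \matrix_(k < tnth lam d) H (d.+1 + k) (q d).
Let P := \mxcol_d C d.

Let H_q d m : (start d <= m)%N -> H m (q d) = 0.
Proof.
move=> le; rewrite -(subnKC le) homog_widenn //; last first.
  by rewrite size_q; have := ideal_start_gt F le_rs d; have := ltn_ord d; lia.
by rewrite H_ideal // iter_mulmxr mul0mx.
Qed.

Let row_C d k : row k (C d) = H (d.+1 + k) (q d).
Proof. by rewrite rowK. Qed.

Let sub_C d : (C d <= P)%MS.
Proof.
apply/row_subP => k.
have -> : row k (C d) = row (tagnat.Rank d k) P; last exact: row_sub.
by rewrite row_mxcol !row_C tagnat.Rank2K /= tagnat.Rank1K.
Qed.

(** Division with remainder: the [q d] have all sizes from 1 to r, and terms of index at least r die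
    because X^r = 0. *)
Let H_sub m (f : {poly F}) : (size f <= m)%N -> (H m f <= P)%MS.
Proof.
elim/ltn_ind: (size f) {-2}f (leqnn (size f)) m => n IHn {}f sfn m sfm.
case: (eqVneq f 0) => [->|f0]; first by rewrite linear0 sub0mx.
have sf0 : (0 < size f)%N by rewrite size_poly_gt0.
case: (ltnP r (size f)) => rf.
  rewrite -[f](poly_take_drop r) linearD /= mulrC.
  have rm : (r <= m)%N by lia.
  rewrite -{2}(subnK rm) homog_mulXn iter_mulmxr X_nil mulmx0 addr0.
  have st := size_take_poly r f.
  by apply: (IHn r) => //; [exact: leq_trans rf sfn | exact: leq_trans st rm].
have dr : ((size f).-1 < r)%N by rewrite prednK.
pose d := Ordinal dr; pose c := lead_coef f / lead_coef (q d).
have sqd : size (q d) = size f by rewrite size_q prednK.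
have q0 : q d != 0 by rewrite -size_poly_gt0 sqd.
have lt_g : (size (f - c *: q d)%R < size f)%N.
  rewrite -[X in (_ < X)%N](prednK sf0) ltnS; apply/leq_sizeP => j jf.
  rewrite coefB coefZ; case: (ltngtP (size f).-1 j) jf => // [lt _|<- _].
    by rewrite !nth_default ?mulr0 ?subr0 // ?sqd -(prednK sf0).
  by rewrite /c -{2}sqd -!lead_coefE divfK ?subrr // lead_coef_eq0.
rewrite -[f](subrK (c *: q d)); move: (f - _) lt_g => g lt_g.
rewrite linearD linearZ addmx_sub ?scalemx_sub //=.
  apply: (IHn (size g)) => //; first exact: leq_trans lt_g sfn.
  exact: leq_trans (ltnW lt_g) sfm.
(* In degree m - 1, [q d] is either already 0 or a row of [C d]. *)
case: (leqP (start d) m) => [le|lt]; first by rewrite H_q ?sub0mx.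
have dm : (d < m)%N by rewrite /= prednK.
have kP : (m - d.+1 < tnth lam d)%N by rewrite lamE; lia.
have := row_C (Ordinal kP); rewrite [X in H X](subnKC dm).
by move=> <-; apply: submx_trans (row_sub _ _) (sub_C d).
Qed.

Let P_stable (A : 'M[F]_N) :
  (forall m (f : {poly F}), (size f <= m)%N -> (H m f *m A <= P)%MS) -> (P *m A <= P)%MS.
Proof.
move=> HA; apply/row_subP => i; rewrite row_mul row_mxcol row_C; apply: HA.
by rewrite size_q leq_addr.
Qed.

Let PX : (P *m X <= P)%MS.
Proof.
apply: P_stable => m f fm; rewrite -[_ *m X]/(mulmxr X _) -homog_mulX.
apply: H_sub; case: (eqVneq f 0) => [->|f0]; first by rewrite mulr0 size_poly0.
by rewrite mulrC size_mulX.
Qed.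

Let PU : (P *m U <= P)%MS.
Proof.
apply: P_stable => m f fm; rewrite -[_ *m U]/(mulmxr U _) -homog_widen //.
by apply: H_sub; rewrite (leq_trans fm).
Qed.

Let X1_unit : 1 + X \in unitmx.
Proof.
have : 1 - (- X) ^+ r = 1 by rewrite exprNn X_nil mulr0 subr0.
rewrite -[X in X - _](expr1n _ r) subrXX_comm; last exact/commr_sym/commr1.
by rewrite opprK -mulmxE => /mulmx1_unit[].
Qed.

(** As 1 + X is invertible, P and P (1 + X) have the same row space, and (1 + X) Y' = Y = U - X. *)
Let PY' : (P *m Y' <= P)%MS.
Proof.
have PX1 : (P *m (1 + X) <= P)%MS by rewrite mulmxDr mulmx1 addmx_sub.
have PX1' : (P <= P *m (1 + X))%MS.
  rewrite -(mxrank_leqif_sup PX1) mxrankMfree // row_free_unit.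
  exact: X1_unit.
apply: submx_trans (submxMr Y' PX1') _.
have -> : P *m (1 + X) *m Y' = P *m (U - X).
  rewrite -mulmxA mulmxE UXY [X + _]addrC addrK /Y.
  by rewrite mulrDl mulrDr mul1r mulr1 commXY'.
by rewrite mulmxBr addmx_sub // eqmx_opp.
Qed.

(** The row space contains [e] and is stable under X and Y', whose monomials carry [e] to the whole
    standard basis. *)
Let P_full : row_full P.
Proof.
rewrite -sub1mx; apply/row_subP => k; rewrite row1.
have eP : (e <= P)%MS.
  have -> : e = H 1 1 by rewrite /homog big_ord1 coef1 scale1r.
  by apply: H_sub; rewrite size_poly1.
have iterP A n : (P *m A <= P)%MS -> (P *m A ^+ n <= P)%MS.
  move=> PA; elim: n => [|n IHn]; first by rewrite expr0 -idmxE mulmx1.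
  by rewrite exprSr -mulmxE mulmxA (submx_trans (submxMr A IHn)).
case: (mxtens_indexP k) => i j.
have -> : delta_mx 0 (mxtens_index (i, j)) = e *m (X ^+ i * Y' ^+ j).
  apply/rowP => l; case: (mxtens_indexP l) => i' j'.
  rewrite -rowE /X /Y' !tensmxX -mulmxE tensmx_mul.
  have E1 n a : (1%:M : 'M[F]_n) ^+ a = 1%:M by rewrite idmxE expr1n.
  rewrite !E1 mul1mx mulmx1 !nil_blockX mxE [RHS]mxE tensmxE !mxE !add0n.
  rewrite (can_eq (@mxtens_indexK _ _)) xpair_eqE -!val_eqE /=.
  by case: eqP; case: eqP => //= *; rewrite ?mul1r ?mul0r.
rewrite -mulmxE mulmxA; apply: submx_trans (iterP Y' j PY').
by apply: submxMr; apply: submx_trans (iterP X i PX); apply: submxMr.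
Qed.

Let sum_lam : (\sum_d tnth lam d = N)%N.
Proof.
have : (\sum_d tnth lam d + \sum_(d < r) d.+1 = N + \sum_(d < r) d.+1)%N.
  rewrite -big_split /=; transitivity (\sum_d start d)%N.
    apply: eq_bigr => d _; rewrite lamE subnK //.
    by have := ideal_start_gt F le_rs d; have := ltn_ord d; lia.
  by rewrite sum_ideal_start big_split sum_nat_const card_ord.
by move/addIn.
Qed.

(** In the basis formed by the rows of P, U moves row k of [C d] to row k + 1 and the last row to
    0. *)
Lemma tensor_similar :
  similar_mx (jordan_block F r *t jordan_block F s)
             (\mxdiag_(d < r) jordan_block F (tnth lam d)).
Proof.
have rP : \rank P = N by apply/eqP; exact: P_full.
have P_free : row_free P by rewrite /row_free rP sum_lam.
(* P is square only up to the equation [sum_lam], hence the pseudo-inverse. *)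
exists (pinvmx P), P; split; [exact: mulVpmx|exact: mulmxVp|].
suff -> : P *m (jordan_block F r *t jordan_block F s) =
          (\mxdiag_(d < r) jordan_block F (tnth lam d)) *m P.
  by rewrite -mulmxA mulmxVp // mulmx1.
rewrite jordan_tensE mulmxDr mulmx1 mul_mxdiag_mxcol mxcol_mul -mxcolD.
apply/eq_mxcol => d; rewrite mulmxDl mul1mx; congr (_ + _).
apply/row_matrixP => k; rewrite !row_mul row_C.
rewrite -[_ *m U]/(mulmxr U _) -homog_widen //; last by rewrite size_q leq_addr.
have nilE : row k (nil_block F (tnth lam d)) *m C d =
    \sum_(l < tnth lam d | l == k.+1 :> nat) row l (C d).
  rewrite mulmx_sum_row [RHS]big_mkcond; apply: eq_bigr => l _; rewrite !mxE.
  by case: eqP; rewrite ?scale1r ?scale0r.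
rewrite nilE; case: (ltnP k.+1 (tnth lam d)) => kl.
  rewrite (big_pred1 (Ordinal kl)) //.
  by rewrite row_C /= addnS.
rewrite big_pred0 => [|l]; last by have := ltn_ord l; lia.
by apply: H_q; have := lamE d; have := ideal_start_gt F le_rs d; lia.
Qed.

End TensorProduct.

Lemma jordan_partition_exists (F : fieldType) (r s : nat) (r_gt0 : (0 < r)%N)
    (le_rs : (r <= s)%N) :
  is_jordan_partition F s [tuple (ideal_start F le_rs d - d.+1)%N | d < r].
Proof.
set lam := [tuple _ | _ < r].
have lamE d : tnth lam d = (ideal_start F le_rs d - d.+1)%N by rewrite tnth_mktuple.
have gt d : (s < ideal_start F le_rs d)%N := ideal_start_gt F le_rs d.
split.
- apply/(sortedP 0%N) => i; rewrite size_tuple => ir.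
  pose a := Ordinal (ltnW ir); pose b := Ordinal ir.
  have := lamE a; have := lamE b; rewrite !(tnth_nth 0%N) /= => -> ->.
  have := @ideal_start_succ F _ _ le_rs a b erefl; rewrite /geq /=; lia.
- apply/allP => x /tnthP[d ->]; rewrite lamE.
  by have := gt d; have := ltn_ord d; lia.
pose q d := s2val (cid2 (ideal_startP F le_rs d)).
apply: (@tensor_similar _ _ _ r_gt0 le_rs lam q lamE) => d; rewrite /q; case: cid2 => //.
Qed.

(** * Uniqueness of the Jordan partition, by ranks *)

Lemma mxrank_nil_blockX (F : fieldType) l k : \rank (nil_block F l ^+ k) = (l - k)%N.
Proof.
set M := nil_block F l ^+ k; have ME : M = \matrix_(i, j) (j == i + k :> nat)%N%:R.
  exact: nil_blockX.
have rk_pid : \rank (pid_mx (l - k) : 'M[F]_l) = (l - k)%N.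
  by rewrite rank_pid_mx ?leq_subr.
have pidM : M = pid_mx (l - k) *m M.
  apply/matrixP => i j; rewrite [RHS]mxE (bigD1 i) //= big1 => [|h hi].
    rewrite ME !mxE eqxx addr0 /=; have := ltn_ord j.
    case: (ltnP i (l - k)) => il jl; rewrite ?mul1r // mul0r.
    by case: eqP => // jik; lia.
  rewrite !mxE; case: eqP => [ih|_]; last by rewrite mul0r.
  by case/eqP: hi; apply: val_inj.
apply/eqP; rewrite eqn_leq; apply/andP; split.
  by rewrite pidM -{2}rk_pid mxrankM_maxl.
rewrite -{1}rk_pid.
suff -> : pid_mx (l - k) = M *m M^T by rewrite mxrankM_maxl.
apply/matrixP => i j; rewrite ME [RHS]mxE mxE.
case: (ltnP (i + k) l) => ik; last first.
  rewrite big1 => [|h _].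
    by case: (ltnP i (l - k)) => il; [lia | rewrite andbF].
  by rewrite !mxE; have := ltn_ord h; case: eqP; rewrite ?mul0r //; lia.
rewrite (bigD1 (Ordinal ik)) //= big1 => [|h hi].
  rewrite !mxE eqxx mul1r addr0 eqn_add2r.
  have -> : (i < l - k)%N by lia.
  by rewrite andbT.
rewrite !mxE; case: eqP => [e|_]; last by rewrite mul0r.
by case/eqP: hi; apply: val_inj.
Qed.

Lemma mul_mxdiag (R : pzSemiRingType) n (p_ : 'I_n -> nat)
    (B C : forall i, 'M[R]_(p_ i)) :
  \mxdiag_i B i *m \mxdiag_i C i = \mxdiag_i (B i *m C i).
Proof.
rewrite {2}/mxdiag mul_mxdiag_mxblock; apply/eq_mxblock => i j.
by case: eqVneq => [->|_]; rewrite ?conform_mx_id // mulmx0.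
Qed.

Lemma mxdiagX (R : pzSemiRingType) n (p_ : 'I_n -> nat)
    (B : forall i, 'M[R]_(p_ i)) k :
  (\mxdiag_i B i) ^+ k = \mxdiag_i (B i ^+ k).
Proof.
elim: k => [|k IHk]; first by rewrite expr0 -idmxE -mxdiagZ.
by rewrite exprS IHk -mulmxE mul_mxdiag; apply/eq_mxdiag => i; rewrite exprS.
Qed.

Lemma similar_mxrank_sub1X (F : fieldType) m n (A : 'M[F]_m) (B : 'M[F]_n) k :
  similar_mx A B -> \rank ((A - 1) ^+ k) = \rank ((B - 1) ^+ k).
Proof.
move=> [P [Q [PQ QP AB]]].
have BE : (B - 1) ^+ k = Q *m (A - 1) ^+ k *m P.
  elim: k => [|k IHk]; first by rewrite !expr0 -!idmxE mulmx1 QP.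
  rewrite !exprSr IHk -!mulmxE.
  have -> : B - 1 = Q *m (A - 1) *m P.
    by rewrite mulmxBr mulmxBl AB -idmxE mulmx1 QP.
  by rewrite !mulmxA -(mulmxA _ P Q) PQ mulmx1.
have AE : (A - 1) ^+ k = P *m (B - 1) ^+ k *m Q.
  by rewrite BE !mulmxA PQ mul1mx -mulmxA PQ mulmx1.
apply/eqP; rewrite eqn_leq; apply/andP; split; [rewrite AE | rewrite BE];
  by rewrite (leq_trans (mxrankM_maxl _ _)) // mxrankM_maxr.
Qed.

(** The left side does not mention [lam], so these sums are the same for any two Jordan
    partitions. *)
Lemma jordan_partition_rank (F : fieldType) r s (lam : r.-tuple nat) k :
  is_jordan_partition F s lam ->
  \rank ((jordan_block F r *t jordan_block F s - 1) ^+ k) = (\sum_i (tnth lam i - k))%N.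
Proof.
move=> [_ _ /similar_mxrank_sub1X->].
rewrite -idmxE -mxdiagZ -mxdiagB.
have -> : \mxdiag_(i < r) (jordan_block F (tnth lam i) - 1%:M) =
          \mxdiag_(i < r) nil_block F (tnth lam i).
  by apply/eq_mxdiag => i; rewrite /jordan_block addrC addKr.
by rewrite mxdiagX rank_mxdiag; apply: eq_bigr => i _; rewrite mxrank_nil_blockX.
Qed.

(** The sums at k and k + 1 differ by the number of parts greater than k, and consecutive such
    numbers differ by a multiplicity. The multiplicity of 0 comes from the length r. *)
Lemma sorted_sum_sub_inj (r : nat) (a b : r.-tuple nat) :
  sorted geq a -> sorted geq b ->
  (forall k, \sum_i (tnth a i - k) = \sum_i (tnth b i - k))%N -> a = b.
Proof.
move=> sa sb ab; apply: val_inj.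
have geq_trans : transitive geq by move=> x y z /=; lia.
have geq_anti : antisymmetric geq by move=> x y /=; lia.
apply: (sorted_eq geq_trans geq_anti sa sb).
have countE (c : r.-tuple nat) k :
    (\sum_i (tnth c i - k) = \sum_i (tnth c i - k.+1) + count (ltn k) c)%N.
  rewrite -sum1_count big_tuple [X in (_ + X)%N]big_mkcond -big_split /=.
  by apply: eq_bigr => i _; case: ltnP; lia.
have gt_eq k : count (ltn k) a = count (ltn k) b.
  by have := countE a k; rewrite ab countE ab => /addnI.
have memE (c : r.-tuple nat) k :
    (count (ltn k) c = count (ltn k.+1) c + count_mem k.+1 c)%N.
  elim: (val c) => //= x l ->; have : ((k < x) = (k.+1 < x) + (x == k.+1) :> nat)%N.
    by lia.
  lia.
apply/allP => x _ /=; apply/eqP; case: x => [|x]; last first.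
  by have := memE a x; rewrite gt_eq memE gt_eq => /addnI.
have zeroE (c : r.-tuple nat) : (r = count (ltn 0) c + count_mem 0%N c)%N.
  rewrite -{1}(size_tuple c) -(count_predC (ltn 0)); congr (_ + _)%N.
  by apply: eq_count => y /=; rewrite -eqn0Ngt.
by apply: (@addnI (count (ltn 0) a)); rewrite -zeroE gt_eq -zeroE.
Qed.

Lemma jordan_partition_unique (F : fieldType) r s (lam lam' : r.-tuple nat) :
  is_jordan_partition F s lam -> is_jordan_partition F s lam' -> lam = lam'.
Proof.
move=> h h'; have [[sl _ _] [sl' _ _]] := (h, h').
apply: sorted_sum_sub_inj => // k.
by rewrite -(jordan_partition_rank k h) (jordan_partition_rank k h').
Qed.

(** * Cut points of sequences and permutations *)

Lemma card_ord_lt (r n : nat) : (n <= r)%N -> #|[set k : 'I_r | (k < n)%N]| = n.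
Proof.
move=> nr; rewrite cardsE -sum1_card (big_ord_narrow nr).
by rewrite sum_nat_const card_ord muln1.
Qed.

Lemma card_ord_ge (r n : nat) : #|[set k : 'I_r | (n <= k)%N]| = (r - n)%N.
Proof.
case: (leqP n r) => [nr|rn].
  have -> : [set k : 'I_r | (n <= k)%N] = ~: [set k : 'I_r | (k < n)%N].
    by apply/setP => k; rewrite !inE -leqNgt.
  by have := cardsC [set k : 'I_r | (k < n)%N]; rewrite card_ord_lt // card_ord; lia.
have -> : [set k : 'I_r | (n <= k)%N] = set0.
  by apply/setP => k; rewrite !inE; have := ltn_ord k; lia.
by rewrite cards0; lia.
Qed.

Section TopCuts.
Variable r : nat.
Implicit Types (e : r.-tuple int) (t : nat).

(* For e in E the map d |-> d + e_d permutes {0, ..., r - 1}; this says that its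
   first t values are the t largest ones. *)
Definition top_cut e t : Prop := forall d, (d < t)%N -> r%:Z - t%:Z <= d%:Z + entry e d.

Lemma in_E_perm e : in_E e ->
  exists2 v : 'I_r -> 'I_r, injective v & forall d, (v d)%:Z = d%:Z + entry e d.
Proof.
move=> /in_EP[_ h2 h3].
have vP (d : 'I_r) : (absz (d%:Z + entry e d)%R < r)%N.
  by have := h3 d (ltn_ord d); lia.
exists (fun d => Ordinal (vP d)) => [d d' [eq_v]|d]; last first.
  by have := h3 d (ltn_ord d); rewrite /=; lia.
apply: val_inj; have := h3 d (ltn_ord d); have := h3 d' (ltn_ord d').
case: (ltngtP d d') => // lt.
  by have := h2 d d' lt (ltn_ord d'); lia.
by have := h2 d' d lt (ltn_ord d); lia.
Qed.

(** By counting, the first t values are exactly the t largest, so injectivity keeps the others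
    below. *)
Lemma top_cut_low e t d : in_E e -> (t <= d < r)%N -> top_cut e t ->
  d%:Z + entry e d < r%:Z - t%:Z.
Proof.
move=> /in_E_perm[v v_inj vE] /andP[td dr] top.
pose A := [set v k | k : 'I_r in [set k : 'I_r | (k < t)%N]].
have AE : A = [set k : 'I_r | (r - t <= k)%N].
  apply/eqP; rewrite eqEcard card_ord_ge card_imset // card_ord_lt; last by lia.
  rewrite subKn ?leqnn ?andbT; last by lia.
  apply/subsetP => _ /imsetP[k + ->]; rewrite !inE => kt.
  by have := top k kt; have := vE k; lia.
have : v (Ordinal dr) \notin A.
  by apply/imsetP => -[k + /v_inj kd]; rewrite inE -kd /=; lia.
by rewrite AE inE; have := vE (Ordinal dr); rewrite /=; lia.
Qed.

(** If e drops at t, then e_i > e_j for i < t <= j, and [in_E_gap] sharpens this to i + e_i > j +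
    e_j: each of the first t values exceeds r - t others. The converse compares indices t - 1 and
    t. *)
Lemma top_cutP e t : in_E e -> (0 < t < r)%N ->
  entry e t < entry e t.-1 <-> top_cut e t.
Proof.
move=> eP /andP[t0 tr]; split=> [lt|top]; last first.
  have ttr : (t <= t < r)%N by rewrite leqnn.
  have pt : (t.-1 < t)%N by lia.
  by have := top_cut_low eP ttr top; have := top _ pt; lia.
have [v v_inj vE] := in_E_perm eP; move=> i it.
have ir : (i < r)%N by lia.
have vij (j : 'I_r) : (t <= j)%N -> (v j < v (Ordinal ir))%N.
  move=> tj; have ij : (i < j)%N by lia.
  have := vE j; have := vE (Ordinal ir); rewrite /=.
  case: (in_E_gap eP ij (ltn_ord j)) => [eij|]; last by lia.
  have /in_EP[h1 _ _] := eP.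
  have pt : (i <= t.-1)%N by lia.
  have ptr : (t.-1 < r)%N by lia.
  by have := h1 i t.-1 pt ptr; have := h1 t j tj (ltn_ord j); lia.
have : (#|[set v k | k : 'I_r in [set k : 'I_r | (t <= k)%N]]| <=
        #|[set k : 'I_r | (k < v (Ordinal ir))%N]|)%N.
  apply/subset_leq_card/subsetP => _ /imsetP[k + ->]; rewrite !inE.
  exact: vij.
rewrite card_imset // card_ord_ge card_ord_lt; last exact: ltnW.
by have := vE (Ordinal ir); rewrite /=; lia.
Qed.

(** Between consecutive cuts e is constant. The cut t' bounds it from below at index t, and the cut
    t bounds it from above at index t' - 1, by the same number. *)
Lemma entry_block (e : Eset r) t t' i : (t <= i < t')%N -> (t' <= r)%N ->
  top_cut (val e) t -> top_cut (val e) t' ->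
  (forall u, (t < u < t')%N -> ~ top_cut (val e) u) ->
  entry (val e) i = r%:Z - t%:Z - t'%:Z.
Proof.
move=> /andP[ti it'] t'r top top' no.
have const a b : (t <= a <= b)%N -> (b < t')%N -> entry (val e) a = entry (val e) b.
  move=> /andP[ta ab] bt'; apply/eqP; rewrite Phi_ET_eq //; last by lia.
  apply/forallP => u; apply/implyP => aub; rewrite inE; apply/negP => lt.
  apply: (no u.+1); first by lia.
  by apply/(top_cutP (valP e)) => //; lia.
have tt' : (t < t')%N by lia.
have lo := top' t tt'; rewrite (const t i) in lo; [|lia|lia].
have hi : (t <= t'.-1 < r)%N by lia.
have := top_cut_low (valP e) hi top; rewrite -(const i t'.-1); [|lia|lia].
by lia.
Qed.

End TopCuts.

(** * Products of reversals and cut points *)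

(** The first m factors preserve the points below [c m] and fix the rest, while the next factor
    fixes the points below [c m]; the claim [y < c m] carries the induction. Points are counted from
    0. *)
Lemma prod_RevP (r : nat) (c : nat -> nat) m : c 0%N = 0%N ->
  (forall k, (k < m)%N -> (c k < c k.+1)%N) -> (c m <= r)%N ->
  forall x : 'I_r, let y := ((\prod_(k < m) Rev r (c k).+1 (c k.+1))%g : 'S_r) x in
  if (x < c m)%N
  then (y < c m)%N /\ (exists k, [/\ (k < m)%N, (c k <= x < c k.+1)%N &
                                 (y.+1 = c k + c k.+1 - x)%N])
  else y = x.
Proof.
move=> c0; elim: m => [|m IHm] c_incr cm x /=.
  by rewrite c0 big_ord0 perm1.
have cmS : (c m < c m.+1)%N by apply: c_incr.
have cm_r : (c m <= r)%N by lia.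
have := IHm (fun k km => c_incr k (ltnW km)) cm_r x.
rewrite big_ord_recr permM permE /=; set y := (_ : 'S_r) x.
have RE := rev_funE y (ltn0Sn (c m)) cm.
case: (ltnP x (c m)) => xm.
  case=> ym [k [km kx yE]].
  have yy : rev_fun (c m).+1 (c m.+1) y = y.
    by apply: val_inj => /=; move: RE; case: ifP; lia.
  rewrite yy (ltn_trans xm cmS); split; first exact: ltn_trans cmS.
  by exists k; split => //; apply: ltnW.
move=> yx; rewrite yx in RE *; case: (ltnP x (c m.+1)) => xm1; last first.
  by apply: val_inj => /=; move: RE; case: ifP; lia.
have xin : (c m < x.+1 <= c m.+1)%N by lia.
rewrite xin in RE.
split; first by lia.
by exists m; split; lia.
Qed.

Section CutPoints.
Variables (r : nat) (T : {set 'I_r.-1}).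
Hypothesis r_gt0 : (0 < r)%N.

(** In [cutpoint] the last value r is only the default of [nth]; here it is a genuine entry, so that
    facts on sorted sequences apply to it. *)
Let cuts := 0%N :: rcons [seq (val t).+1 | t <- enum T] r.

Lemma cutpointE k : cutpoint T k = nth r cuts k.
Proof. by rewrite /cutpoint /cuts -rcons_cons nth_rcons_default. Qed.

Lemma size_cuts : size cuts = #|T|.+2.
Proof. by rewrite /= size_rcons size_map -cardE. Qed.

Lemma sorted_cuts : sorted ltn cuts.
Proof.
have sT : sorted ltn [seq val t | t <- enum T].
  rewrite sorted_map /enum_mem; apply: sorted_filter => [x y z|].
    exact: ltn_trans.
  by rewrite -enumT -sorted_map val_enum_ord iota_ltn_sorted.
have path0 : path ltn 0%N [seq (val t).+1 | t <- enum T].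
  rewrite (map_comp succn val).
  case: [seq val t | t <- enum T] sT => //= x l.
  by rewrite path_map.
rewrite /= rcons_path path0 /=.
case/lastP: (enum T) => [|l x]; first by rewrite /=.
by rewrite map_rcons last_rcons; have := ltn_ord x; lia.
Qed.

Lemma cutpoint_ltn k : (k <= #|T|)%N -> (cutpoint T k < cutpoint T k.+1)%N.
Proof.
move=> kT; rewrite !cutpointE; apply: (sorted_ltn_nth ltn_trans _ sorted_cuts) => //;
  by rewrite inE size_cuts; lia.
Qed.

Lemma cutpoint_last : cutpoint T #|T|.+1 = r.
Proof. by rewrite /cutpoint nth_default //= size_map -cardE. Qed.

Lemma mem_cuts u : u \in cuts = [|| u == 0%N, u == r | [exists t in T, u == t.+1]].
Proof.
rewrite inE mem_rcons inE; congr [|| _, _ | _].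
apply/mapP/exists_inP => [[t tT ->]|[t tT /eqP->]]; exists t => //.
  by rewrite mem_enum in tT.
by rewrite mem_enum.
Qed.

Lemma cutpoint_mem k : (k <= #|T|.+1)%N -> cutpoint T k \in cuts.
Proof. by move=> kT; rewrite cutpointE mem_nth // size_cuts. Qed.

Lemma cutpoint_gap k u : (k <= #|T|)%N -> (cutpoint T k < u < cutpoint T k.+1)%N ->
  u \notin cuts.
Proof.
rewrite !cutpointE => kT /andP[ku uk]; apply/negP => u_in.
have idx : (index u cuts < size cuts)%N by rewrite index_mem.
have mono := sorted_ltn_nth ltn_trans r sorted_cuts.
have nthu := nth_index r u_in.
case: (ltngtP (index u cuts) k) => ik.
- by have := mono _ _ idx _ ik; rewrite inE size_cuts nthu; lia.
- case: (ltngtP (index u cuts) k.+1) => ik1; [lia| |].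
    by have := mono _ _ _ idx ik1; rewrite inE size_cuts nthu; lia.
  by move: uk; rewrite -ik1 nthu ltnn.
- by move: ku; rewrite -ik nthu ltnn.
Qed.

End CutPoints.

(** * The functions L and R *)

Section LeftRight.
Variables (r s p : nat).

Lemma delta0 : prime p -> delta r s p 0.
Proof.
move=> p_prime; rewrite /delta /Ddet det_mx00 dvdzE absz1 dvdn1.
by rewrite neq_ltn /= prime_gt1 ?orbT.
Qed.

Lemma LfunP n : (0 < n)%N -> prime p ->
  [/\ (0 < Lfun r s p n <= n)%N, delta r s p (n - Lfun r s p n) &
      forall u, (n - Lfun r s p n < u < n)%N -> ~~ delta r s p u].
Proof.
move=> n0 p_prime; rewrite /Lfun; case: arg_minnP => [|l /andP[l0 dl] l_min].
  by rewrite /= n0 subnn delta0.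
split=> // [|u lu]; first by rewrite l0 -ltnS ltn_ord.
have unP : (n - u < n.+1)%N by lia.
apply/negP => du; have := l_min (Ordinal unP); rewrite /= subKn; last by lia.
by rewrite du andbT; move=> /(_ _); lia.
Qed.

(** That p does not divide D_r is assumed here; [delta_r] derives it from the strings instead of
    evaluating the determinant. *)
Lemma RfunP n : (n <= r)%N -> delta r s p r ->
  [/\ (n + Rfun r s p n <= r)%N, delta r s p (n + Rfun r s p n) &
      forall u, (n <= u < n + Rfun r s p n)%N -> ~~ delta r s p u].
Proof.
move=> nr dr; rewrite /Rfun; case: arg_minnP => [|k dk k_min].
  by rewrite /= subnKC.
split=> // [|u uk]; first by have := ltn_ord k; lia.
have unP : (u - n < (r - n).+1)%N by have := ltn_ord k; lia.
apply/negP => du; have := k_min (Ordinal unP); rewrite /= subnKC; last by lia.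
by move=> /(_ du); lia.
Qed.

End LeftRight.

Lemma entry_tnth r (e : r.-tuple int) (i : 'I_r) : entry e i = tnth e i.
Proof. by rewrite (tnth_nth 0). Qed.

(** * The sequence epsilon, its cuts and the permutation pi *)

Section JordanPartition.
Variables (r s p : nat) (F : fieldType) (lam : r.-tuple nat).
Hypotheses (r_gt0 : (0 < r)%N) (le_rs : (r <= s)%N).
Hypothesis lamP : is_jordan_partition F s lam.

Let e := jordan_eps s lam.
Let start := ideal_start F le_rs.

Lemma jordan_epsE (d : 'I_r) : entry e d = (start d)%:Z - d.+1%:Z - s%:Z.
Proof.
rewrite entry_tnth tnth_mktuple.
rewrite (jordan_partition_unique lamP (jordan_partition_exists F r_gt0 le_rs)).
rewrite tnth_mktuple -/start.
by have := ideal_start_gt F le_rs d; have := ltn_ord d; rewrite -/start; lia.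
Qed.

(** Monotonicity is [ideal_start_succ], the gap condition is injectivity of [ideal_start], and the
    bounds are s < start d <= r + s. *)
Lemma jordan_eps_in_E : in_E e.
Proof.
apply/in_EP; split=> [i j ij jr|i j ij jr|i ir].
- elim: j ij jr => [|j IHj]; first by rewrite leqn0 => /eqP->.
  rewrite leq_eqVlt => /predU1P[-> //|ij] jr.
  apply: le_trans (IHj ij (ltnW jr)).
  have := @ideal_start_succ F _ _ le_rs (Ordinal (ltnW jr)) (Ordinal jr) erefl.
  have := jordan_epsE (Ordinal (ltnW jr)); have := jordan_epsE (Ordinal jr).
  by rewrite /= -/start; lia.
- have ir := ltn_trans ij jr => eq_ij.
  have := jordan_epsE (Ordinal ir); have := jordan_epsE (Ordinal jr); rewrite /= => ej ei.
  have /ideal_start_inj/(congr1 val)/= : start (Ordinal ir) = start (Ordinal jr) by lia.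
  by lia.
have := jordan_epsE (Ordinal ir); rewrite /= => ->.
have := ideal_start_gt F le_rs (Ordinal ir); have := ideal_start_le F le_rs (Ordinal ir).
by rewrite -/start; lia.
Qed.

Hypothesis charF : p \in [pchar F].

(** Both sides say that start d > r + s - t for every d < t. *)
Lemma delta_top_cut t : (t <= r)%N -> delta r s p t <-> top_cut e t.
Proof.
move=> tr; rewrite (delta_sing charF tr le_rs) (sing_atP F le_rs tr).
split=> [no d dt|top [d dt le]].
  have dr : (d < r)%N by lia.
  rewrite (jordan_epsE (Ordinal dr)) /=.
  case: (leqP (start (Ordinal dr)) (r + s - t)) => [le|]; last by lia.
  by case: no; exists (Ordinal dr).
by have := top d dt; rewrite jordan_epsE /start; lia.
Qed.

Let E : Eset r := exist _ e jordan_eps_in_E.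

Lemma Phi_ET_jordan_eps : Phi_ET E = Tset r s p.
Proof.
apply/setP => t; rewrite !inE /=.
have tr : (t.+1 < r)%N by have := ltn_ord t; lia.
have [h1 h2] := top_cutP (t := t.+1) jordan_eps_in_E tr.
have [h3 h4] := delta_top_cut (ltnW tr).
by apply/idP/idP => h; [apply/h4/h1 | apply/h2/h3].
Qed.

Lemma delta_r : delta r s p r.
Proof.
apply/(delta_top_cut (leqnn r)) => d dr; rewrite (jordan_epsE (Ordinal dr)) /=.
by have := ideal_start_gt F le_rs (Ordinal dr); rewrite -/start; lia.
Qed.

Lemma jordan_eps_block t t' i : (t <= i < t')%N -> (t' <= r)%N ->
  delta r s p t -> delta r s p t' ->
  (forall u, (t < u < t')%N -> ~~ delta r s p u) ->
  entry e i = r%:Z - t%:Z - t'%:Z.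
Proof.
move=> tit' t'r dt dt' no; apply: (@entry_block r E) => //.
- by apply/delta_top_cut => //; lia.
- exact/delta_top_cut.
have ur u : (t < u < t')%N -> (u <= r)%N by lia.
by move=> u ut /(delta_top_cut (ur u ut)); apply/negP/no.
Qed.

Hypothesis p_prime : prime p.

Lemma tnth_jordan_partition (i : 'I_r) :
  (tnth lam i)%:Z = r%:Z + s%:Z - 2 * i.+1%:Z + (Lfun r s p i.+1)%:Z - (Rfun r s p i.+1)%:Z.
Proof.
have [L0 dL Lmin] := LfunP r s (ltn0Sn i) p_prime.
have [Rr dR Rmin] := RfunP (ltn_ord i) delta_r.
(* With n = i + 1, the consecutive cuts around index i are n - L(n) and n + R(n). *)
have := @jordan_eps_block _ _ i _ Rr dL dR.
rewrite entry_tnth tnth_mktuple => h.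
have {}h := h _ _; suff : (tnth lam i)%:Z - s%:Z =
  r%:Z - (i.+1 - Lfun r s p i.+1)%N%:Z - (i.+1 + Rfun r s p i.+1)%N%:Z by lia.
apply: h => [|u uLR]; first by lia.
by case: (ltnP u i.+1) => ui; [apply: Lmin | apply: Rmin]; lia.
Qed.

Lemma mem_cuts_delta u : u \in 0%N :: rcons [seq (val t).+1 | t <- enum (Tset r s p)] r =
  (u <= r)%N && delta r s p u.
Proof.
rewrite mem_cuts; case: eqP => [->|u0]; first by rewrite delta0.
case: eqP => [->|ur]; first by rewrite leqnn delta_r.
apply/exists_inP/andP => [[t]|[le du]].
  by rewrite inE => dt /eqP->; split=> //; have := ltn_ord t; lia.
have uP : (u.-1 < r.-1)%N by lia.
by exists (Ordinal uP); rewrite ?inE /= prednK //; lia.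
Qed.

Lemma jordan_pi_cuts (i : 'I_r) :
  jordan_pi s lam i = (Phi_TPi (Tset r s p) i).+1%:Z.
Proof.
set T := Tset r s p.
have := @prod_RevP r (cutpoint T) #|T|.+1 erefl (cutpoint_ltn r_gt0) _ i.
(* On the block of [i] the product of reversals gives t_k + t_(k+1) - i, to be matched with r - i -
   [entry e i]. *)
rewrite cutpoint_last leqnn ltn_ord => /(_ isT)[_ [k [kT ki ->]]].
have cutP k' : (k' <= #|T|.+1)%N -> (cutpoint T k' <= r)%N && delta r s p (cutpoint T k').
  by move=> k'T; rewrite -mem_cuts_delta cutpoint_mem.
have /andP[_ dk] := cutP k (ltnW kT).
have /andP[kr dk1] := cutP k.+1 kT.
have := jordan_eps_block ki kr dk dk1 => h.
have {}h := h _; rewrite /jordan_pi.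
suff : entry e i = r%:Z - (cutpoint T k)%:Z - (cutpoint T k.+1)%:Z.
  by rewrite entry_tnth tnth_mktuple; lia.
apply: h => u uk; have := cutpoint_gap r_gt0 kT uk.
by rewrite mem_cuts_delta; case: (leqP u r) => //; lia.
Qed.

End JordanPartition.

Theorem theorem4p1 (r s p : nat) (F : fieldType) (lam : r.-tuple nat)
    (r_ge1 : (1 <= r)%N) (le_rs : (r <= s)%N) (p_prime : prime p)
    (charF : p \in [pchar F]) (lamP : is_jordan_partition F s lam) :
  let T := Tset r s p in
  [/\ (* (a) *)
      jordan_eps s lam = val (Phi_TE T) /\ in_E (jordan_eps s lam),
      (* (b) *)
      (forall i : 'I_r, jordan_pi s lam i = (Phi_TPi T i).+1%:Z) /\
      Phi_TPi T =
        (\prod_(i < #|T|.+1) Rev r (cutpoint T i).+1 (cutpoint T i.+1))%g,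
      (* (c) *)
      forall i : 'I_r, let n := i.+1 in
        jordan_pi s lam i =
          n%:Z + 1 - (Lfun r s p n)%:Z + (Rfun r s p n)%:Z &
      (* (d) *)
      forall i : 'I_r, let n := i.+1 in
        (tnth lam i)%:Z =
          r%:Z + s%:Z - 2 * n%:Z + (Lfun r s p n)%:Z - (Rfun r s p n)%:Z].
Proof.
have T_eps := Phi_ET_jordan_eps r_ge1 le_rs lamP charF.
have tnthE := tnth_jordan_partition r_ge1 le_rs lamP charF p_prime.
split.
- by split; [rewrite -T_eps Phi_ETK | apply: (jordan_eps_in_E r_ge1 le_rs lamP)].
- by split=> // i; apply: (@jordan_pi_cuts r s p F).
(* Statement (c) is (d) substituted into the definition of pi. *)
- by move=> i /=; rewrite /jordan_pi tnthE; lia.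
exact: tnthE.
Qed.
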